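(* Let $n \geq 2$, and let $\mathbb{F}$ be a field with $\operatorname{char}(\mathbb{F})=2$ and $|\mathbb{F}|>2$. Then the greatest possible dimension for a $1^\star$-spec linear subspace of $\operatorname{M}_n(\mathbb{F})$ is $\binom{n}{2}+2$, and it is also the greatest possible dimension for a $\overline{1}^\star$-spec linear subspace of $\operatorname{M}_n(\mathbb{F})$.
   Context: $\operatorname{M}_n(\mathbb{F})$ is the algebra of $n\times n$ matrices over $\mathbb{F}$, and $\overline{\mathbb{F}}$ is an algebraic closure of $\mathbb{F}$. For a field extension $\mathbb{L}$ of $\mathbb{F}$, $\operatorname{Sp}_{\mathbb{L}}(x)$ is the set of roots in $\mathbb{L}$ of the minimal polynomial of $x$. An $\mathbb{F}$-linear subspace $\mathcal{S}$ of $\operatorname{M}_n(\mathbb{F})$ is called $1^\star$-spec if $\#(\operatorname{Sp}_{\mathbb{F}}(x)\setminus\{0\})\leq 1$ for all $x\in\mathcal{S}$, and $\overline{1}^\star$-spec if $\#(\operatorname{Sp}_{\overline{\mathbb{F}}}(x)\setminus\{0\})\leq 1$ for all $x\in\mathcal{S}$. *)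

(* Defs.v *)
From mathcomp Require Import all_boot all_order all_algebra.
From mathcomp Require Import classical_sets cardinality.

Set Implicit Arguments.
Unset Strict Implicit.
Unset Printing Implicit Defensive.

Import GRing.Theory.
Local Open Scope ring_scope.
Local Open Scope classical_set_scope.
Local Open Scope card_scope.

(* An extension L of F is given by its embedding iota; the size is n.+1
   because mxminpoly is only defined on nonempty square matrices. *)
Definition Sp (F L : fieldType) (iota : {rmorphism F -> L}) (n : nat)
    (x : 'M[F]_n.+1) : set L :=
  [set a | root (map_poly iota (mxminpoly x)) a].

Definition star_spec_in (F L : fieldType) (iota : {rmorphism F -> L}) (n : nat)
    (S : {vspace 'M[F]_n.+1}) : Prop :=
  forall x, x \in S -> Sp iota x `\ 0 #<= `I_1.

Definition one_star_spec (F : fieldType) (n : nat)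
    (S : {vspace 'M[F]_n.+1}) : Prop :=
  star_spec_in (idfun : {rmorphism F -> F}) S.

Definition is_algebraic_closure (F : fieldType) (Fbar : closedFieldType)
    (iota : {rmorphism F -> Fbar}) : Prop :=
  forall z : Fbar, algebraicOver iota z.

Definition one_bar_star_spec (F : fieldType) (Fbar : closedFieldType)
    (iota : {rmorphism F -> Fbar}) (n : nat)
    (S : {vspace 'M[F]_n.+1}) : Prop :=
  star_spec_in iota S.

Definition greatest_dim (F : fieldType) (V : vectType F)
    (P : {vspace V} -> Prop) (d : nat) : Prop :=
  (exists2 S : {vspace V}, P S & \dim S = d) /\
  (forall S : {vspace V}, P S -> (\dim S <= d)%N).

(* Main.v *)
(* Upper bound. Induct on the size [n], also proving that in the equality case
   every coset of the space contains a matrix with any prescribed eigenvalue.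
   Let [x] be a vector such that no nonzero [M] in the space [V] satisfies
   [M x = 0] and [im M <= <x>]. The stabiliser [U = {M in V | M x = 0}] then embeds
   in the matrices on the quotient by [x], and [dim V = dim (V x) + dim U]. If [V x]
   is everything and [U] has the maximal dimension, take [A] in [V] with [A x = x]:
   the coset property in the quotient gives [M] in [U] such that [A + M] has an
   eigenvalue other than [0] and [1], a contradiction.
   Such an [x] exists for [V] or for its transpose when [n > 2]: otherwise every
   vector and every linear form carries a rank one square-zero matrix of [V], and
   combining a few of these gives an element of [V] with two prescribed distinct
   nonzero eigenvalues [1] and [u].
   The bound is attained by a [2 x 2] trace zero block followed by a strictly
   upper triangular part. *)
Require Import Defs.
From HB Require Import structures.
From mathcomp Require Import all_boot all_order all_algebra.
From mathcomp Require Import classical_sets cardinality.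
From mathcomp Require Import boolp functions ring zify.

Set Implicit Arguments.
Unset Strict Implicit.
Unset Printing Implicit Defensive.

Import GRing.Theory.
Local Open Scope ring_scope.

(** * Eigenvalues and transposition *)

(** Phrased with [eigenvalue] over [F] and for every size [n], as the induction on the size
    requires. *)
Definition at_most_one_nz_eigenvalue (F : fieldType) (n : nat)
    (V : {vspace 'M[F]_n}) : Prop :=
  forall M a b, M \in V -> a != 0 -> b != 0 ->
    eigenvalue M a -> eigenvalue M b -> a = b.

(** [eigenvalue] refers to row eigenvectors; transposing, which keeps the characteristic polynomial,
    gives access to column eigenvectors. *)
Lemma eigenvalue_trmx (F : fieldType) n (M : 'M[F]_n) a :
  eigenvalue M^T a = eigenvalue M a.
Proof.
rewrite !eigenvalue_root_char /char_poly; congr (root _ _).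
rewrite -[in RHS]det_tr; congr (\det _).
by apply/matrixP=> i j; rewrite !mxE [j == i]eq_sym.
Qed.

Lemma eigenvalue_col (F : fieldType) n (M : 'M[F]_n) (v : 'cV_n) a :
  M *m v = a *: v -> v != 0 -> eigenvalue M a.
Proof.
move=> Mv v0; rewrite -eigenvalue_trmx; apply/eigenvalueP; exists v^T.
  by rewrite -trmx_mul Mv linearZ.
by apply: contra_neq v0 => v0; rewrite -[v]trmxK v0 trmx0.
Qed.

Lemma eigenvalue_mulmxC (F : fieldType) m n (P : 'M[F]_(m, n)) (R : 'M_(n, m)) a :
  a != 0 -> eigenvalue (R *m P) a -> eigenvalue (P *m R) a.
Proof.
move=> a0 /eigenvalueP[w wRP w0]; apply/eigenvalueP; exists (w *m R).
  by rewrite mulmxA -(mulmxA w R P) wRP scalemxAl.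
apply: contra_neq w0 => wR0; move: wRP; rewrite mulmxA wR0 mul0mx => /esym/eqP.
by rewrite scaler_eq0 (negPf a0) => /eqP.
Qed.

(** * Linear forms, vectors and rank one matrices *)

(** Rows act as linear forms on columns; [x *m phi] is then a rank one map, of square zero when
    [pairing phi x = 0]. *)
Definition pairing (F : fieldType) n (phi : 'rV[F]_n) (x : 'cV[F]_n) : F :=
  (phi *m x) 0 0.

Lemma pairingE (F : fieldType) n (phi : 'rV[F]_n) x :
  phi *m x = (pairing phi x)%:M.
Proof. exact: mx11_scalar. Qed.

Lemma pairing_suml (F : fieldType) n (I : Type) (r : seq I) (P : pred I)
    (phi : I -> 'rV[F]_n) x :
  pairing (\sum_(i <- r | P i) phi i) x = \sum_(i <- r | P i) pairing (phi i) x.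
Proof. by rewrite /pairing mulmx_suml summxE. Qed.

Lemma pairing_sumr (F : fieldType) n (I : Type) (r : seq I) (P : pred I)
    (phi : 'rV[F]_n) (x : I -> 'cV_n) :
  pairing phi (\sum_(i <- r | P i) x i) = \sum_(i <- r | P i) pairing phi (x i).
Proof. by rewrite /pairing mulmx_sumr summxE. Qed.

Lemma pairingDl (F : fieldType) n (phi psi : 'rV[F]_n) x :
  pairing (phi + psi) x = pairing phi x + pairing psi x.
Proof. by rewrite /pairing mulmxDl mxE. Qed.

Lemma pairingDr (F : fieldType) n (phi : 'rV[F]_n) x y :
  pairing phi (x + y) = pairing phi x + pairing phi y.
Proof. by rewrite /pairing mulmxDr mxE. Qed.

Lemma pairingZl (F : fieldType) n a (phi : 'rV[F]_n) x :
  pairing (a *: phi) x = a * pairing phi x.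
Proof. by rewrite /pairing -scalemxAl mxE. Qed.

Lemma pairingZr (F : fieldType) n a (phi : 'rV[F]_n) x :
  pairing phi (a *: x) = a * pairing phi x.
Proof. by rewrite /pairing -scalemxAr mxE. Qed.

Lemma pairing0l (F : fieldType) n (x : 'cV[F]_n) : pairing 0 x = 0.
Proof. by rewrite /pairing mul0mx mxE. Qed.

Lemma pairing0r (F : fieldType) n (phi : 'rV[F]_n) : pairing phi 0 = 0.
Proof. by rewrite /pairing mulmx0 mxE. Qed.

Lemma pairing_tr (F : fieldType) n (phi : 'rV[F]_n) x :
  pairing x^T phi^T = pairing phi x.
Proof. by rewrite /pairing -trmx_mul mxE. Qed.

Lemma pairing_mulmx (F : fieldType) n (phi : 'rV[F]_n) (M : 'M_n) x :
  pairing (phi *m M) x = pairing phi (M *m x).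
Proof. by rewrite /pairing mulmxA. Qed.

Lemma mulmx_rank1_col (F : fieldType) n (x : 'cV[F]_n) (phi : 'rV_n) y :
  x *m phi *m y = pairing phi y *: x.
Proof. by rewrite -mulmxA (pairingE phi) mul_mx_scalar. Qed.

Lemma mulmx_rank1_row (F : fieldType) n (psi : 'rV[F]_n) x (phi : 'rV_n) :
  psi *m (x *m phi) = pairing psi x *: phi.
Proof. by rewrite mulmxA pairingE mul_scalar_mx. Qed.

Lemma exists_pairing_delta_neq0 (F : fieldType) n (phi : 'rV[F]_n) :
  phi != 0 -> exists i : 'I_n, pairing phi (delta_mx i 0) != 0.
Proof.
move/rV0Pn=> [i phii]; exists i; rewrite /pairing -colE mxE //.
Qed.

(** * Induced cycles and generic vectors *)

(* Minimality of [S] among the nonempty sets in which every vertex keeps an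
   out-neighbour forces [g @: S = S] for every choice [g] of out-neighbours,
   which makes the out-neighbour unique. *)
Lemma induced_cycle (T : finType) (e : rel T) (x0 : T) :
  (forall i, exists j, e i j) ->
  exists (S : {set T}) (f : T -> T),
    [/\ S != finset.set0, {in S, forall i, f i \in S}, {in S &, injective f}
      & {in S &, forall i j, e i j = (j == f i)}].
Proof.
move=> he.
pose P (S : {set T}) := (S != finset.set0) && [forall i in S, [exists j in S, e i j]].
have PT : P [set: T]%SET.
  apply/andP; split; first by apply/set0Pn; exists x0.
  by apply/forall_inP=> i _; have [j ej] := he i; apply/exists_inP; exists j.
have [S /minsetP[/andP[S0 /forall_inP Sout] Smin] _] := minset_exists PT.
have imS g : {in S, forall i, g i \in S} -> {in S, forall i, e i (g i)} -> g @: S = S.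
  move=> gS ge; apply: Smin; last by apply/fintype.subsetP=> _ /imsetP[i iS ->]; exact: gS.
  apply/andP; split.
    by have [i iS] := set0Pn _ S0; apply/set0Pn; exists (g i); apply: imset_f.
  apply/forall_inP=> _ /imsetP[i iS ->]; apply/exists_inP.
  by exists (g (g i)); [apply: imset_f; exact: gS | exact/ge/gS].
(* The default [i] only serves outside [S]. *)
pose f i := odflt i [pick j in S | e i j].
have fP i : i \in S -> (f i \in S) /\ e i (f i).
  move=> iS; rewrite /f; case: pickP => [j /andP[]//|no].
  by have /exists_inP[j jS eij] := Sout i iS; move: (no j); rewrite jS eij.
have fS : {in S, forall i, f i \in S} by move=> i /fP[].
have fe : {in S, forall i, e i (f i)} by move=> i /fP[].
have finj : {in S &, injective f} by apply/imset_injP; rewrite (imS f).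
exists S, f; split => // i j iS jS.
apply/idP/eqP => [eij|->]; last exact: fe.
apply/eqP/negPn/negP => jf.
(* [g] differs from [f] only at [i]. Being onto [S], it attains [f i], but not at [i], and by
   injectivity of [f] nowhere else. *)
pose g k := if k == i then j else f k.
have gSS : g @: S = S.
  apply: imS => k kS; rewrite /g; case: eqP => [ki|_]; rewrite ?ki //; [exact: fS|exact: fe].
have : f i \in g @: S by rewrite gSS; exact: fS.
case/imsetP => k kS; rewrite /g; case: (eqVneq k i) => [_ fj|ki fk].
  by rewrite fj eqxx in jf.
by move: ki; rewrite (finj _ _ iS kS fk) eqxx.
Qed.

(** On an induced cycle, [phi i] sees only the term [x (f i)] of [v]. With [t i] the inverse of that
    value, the [i]-th summand sends [v] to [x i], and these add up to [v]. *)
Lemma exists_eigenvalue1 (F : fieldType) n (T : finType) (t0 : T)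
    (x : T -> 'cV[F]_n) (phi : T -> 'rV_n) :
  (forall i, exists j, pairing (phi i) (x j) != 0) ->
  exists (S : {set T}) (t : T -> F) (v := \sum_(i in S) x i),
    v != 0 /\ (\sum_i t i *: (x i *m phi i)) *m v = v.
Proof.
move=> /(induced_cycle t0)[S [f [S0 fS finj fE]]].
pose t i := if i \in S then (pairing (phi i) (x (f i)))^-1 else 0.
have phiv i : i \in S -> pairing (phi i) (\sum_(i in S) x i) = pairing (phi i) (x (f i)).
  move=> iS; rewrite pairing_sumr (bigD1 (f i)) ?fS //= big1 ?addr0 // => j /andP[jS jf].
  by apply/eqP; move: (fE i j iS jS); rewrite (negPf jf) => /negbFE.
have phin i : i \in S -> pairing (phi i) (x (f i)) != 0.
  by move=> iS; rewrite (fE i (f i)) ?fS.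
exists S, t => v; split.
  have [i iS] := set0Pn _ S0; apply: contraNneq (phin i iS) => v0.
  by rewrite -phiv // -/v v0 pairing0r.
rewrite mulmx_suml [RHS]big_mkcond /=; apply: eq_bigr => i _.
rewrite -scalemxAl mulmx_rank1_col scalerA /t; case: ifP => iS.
  by rewrite phiv // mulVf ?scale1r ?phin.
by rewrite mul0r scale0r.
Qed.

Lemma memv_trmx_img (F : fieldType) n (V : {vspace 'M[F]_n}) M :
  (M \in (linfun (@trmx F n n) @: V)%VS) = (M^T \in V).
Proof.
apply/idP/idP => [/memv_imgP[N NV ->]|MV]; first by rewrite lfunE /= trmxK.
by apply/memv_imgP; exists M^T; rewrite // lfunE /= trmxK.
Qed.

Lemma at_most_one_nz_eigenvalue_trmx (F : fieldType) n (V : {vspace 'M[F]_n}) :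
  at_most_one_nz_eigenvalue V ->
  at_most_one_nz_eigenvalue (linfun (@trmx F n n) @: V)%VS.
Proof.
move=> hV M a b; rewrite memv_trmx_img => MV a0 b0 Ma Mb.
by apply: (hV M^T); rewrite ?eigenvalue_trmx.
Qed.

(* The columns of [rho] span a space killed by [N], and [w] is an eigenvector
   of [N] killing that space: if every [x] outside the hyperplane [theta = 0] of
   that space had a bad [phi], an induced cycle among those [x] would give
   [M + u N] in [V] with eigenvalues [1] (on the right) and [u] (on the left). *)
Lemma exists_generic_vector (F : fieldType) n (V : {vspace 'M[F]_n}) (u : F)
    (N rho : 'M[F]_n) (w theta : 'rV[F]_n) :
  at_most_one_nz_eigenvalue V -> u != 0 -> u != 1 ->
  N \in V -> w *m N = w -> w != 0 -> N *m rho = 0 -> w *m rho = 0 ->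
  theta *m rho != 0 ->
  exists x : 'cV_n, [/\ exists y, x = rho *m y, pairing theta x != 0
    & forall phi, x *m phi \in V -> phi *m rho = 0].
Proof.
move=> hV u0 u1 NV wN w0 Nrho wrho threrho.
apply: contrapT => no.
have [i0 hi0] := exists_pairing_delta_neq0 threrho.
pose h i : 'cV[F]_n := rho *m delta_mx i 0.
(* Adding [h i0] leaves the hyperplane [theta = 0], and the [x i] still span the column space of
   [rho]. *)
pose x i := if pairing theta (h i) == 0 then h i + h i0 else h i.
have thi0 : pairing theta (h i0) != 0 by rewrite -pairing_mulmx.
have xth i : pairing theta (x i) != 0.
  rewrite /x; case: ifPn => // /eqP th0; by rewrite pairingDr th0 add0r.
have xrho i : exists y, x i = rho *m y.
  by rewrite /x; case: ifP => _; rewrite /h -?mulmxDr; eexists.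
have /(fin_all_exists (T := 'I_n))[phi phiP] (i : 'I_n) :
    exists phi : 'rV_n, x i *m phi \in V /\ phi *m rho <> 0.
  apply: contrapT => nophi; apply: no; exists (x i); split => // phi xV.
  by apply: contrapT => phi0; apply: nophi; exists phi.
have hx i : exists j, pairing (phi i) (x j) != 0.
  apply: contrapT => noj; have [_ /eqP/exists_pairing_delta_neq0[j]] := phiP i; apply/negP/negPn.
  have xj k : pairing (phi i) (x k) = 0.
    by apply/eqP/negPn/negP => hk; apply: noj; exists k.
  rewrite pairing_mulmx -/(h j).
  have hi00 : pairing (phi i) (h i0) = 0 by move: (xj i0); rewrite /x (negPf thi0).
  by move: (xj j); rewrite /x; case: ifP => _; rewrite ?pairingDr ?hi00 ?addr0 => ->.
have [S [t /= [v0 Mv]]] := exists_eigenvalue1 i0 hx.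
set v := (\sum_(i in S) x i) in v0 Mv; set M := (\sum_i _) in Mv.
have MV : M \in V by apply: rpred_sum => i _; apply: rpredZ; case: (phiP i).
have [y vy] : exists y, v = rho *m y.
  have [y yP] := fin_all_exists xrho.
  by exists (\sum_(i in S) y i); rewrite mulmx_sumr; apply: eq_bigr.
have wx i : pairing w (x i) = 0.
  by have [z ->] := xrho i; rewrite -pairing_mulmx wrho pairing0l.
have wM : w *m M = 0.
  rewrite mulmx_sumr big1 // => i _.
  by rewrite -scalemxAr mulmx_rank1_row wx scale0r scaler0.
move: u1; rewrite eq_sym => /eqP; apply.
apply: (hV (M + u *: N)); rewrite ?oner_eq0 //.
- by rewrite rpredD ?rpredZ.
- apply: (eigenvalue_col (v := v)) => //.
  by rewrite mulmxDl Mv -scalemxAl vy mulmxA Nrho mul0mx scaler0 addr0 scale1r.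
- by apply/eigenvalueP; exists w; rewrite // mulmxDr wM add0r -scalemxAr wN.
Qed.

(** * Prescribing eigenvalues of sums of rank one matrices *)

(** The sum factors as [P *m R] through dimension 3, so its nonzero eigenvalues are those of the
    Gram matrix [R *m P], whose characteristic determinant is the expression in the hypothesis. *)
Lemma eigenvalue_sum_rank1 (F : fieldType) n (x1 x2 x3 : 'cV[F]_n)
    (r1 r2 r3 : 'rV[F]_n) l (g := fun r x => pairing r x) :
  l != 0 ->
  (g r1 x1 - l) * ((g r2 x2 - l) * (g r3 x3 - l) - g r2 x3 * g r3 x2)
  - g r1 x2 * (g r2 x1 * (g r3 x3 - l) - g r2 x3 * g r3 x1)
  + g r1 x3 * (g r2 x1 * g r3 x2 - (g r2 x2 - l) * g r3 x1) = 0 ->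
  eigenvalue (x1 *m r1 + x2 *m r2 + x3 *m r3) l.
Proof.
move=> l0 dl.
pose P : 'M[F]_(n, 3) := \matrix_(i, j) (nth 0 [:: x1; x2; x3] j) i 0.
pose R : 'M[F]_(3, n) := \matrix_(i, j) (nth 0 [:: r1; r2; r3] i) 0 j.
have -> : x1 *m r1 + x2 *m r2 + x3 *m r3 = P *m R.
  by apply/matrixP => i j; rewrite !mxE !big_ord_recl !big_ord0 !mxE !addr0 /= addrA.
apply: eigenvalue_mulmxC => //.
have RP i j : (R *m P) i j = g (nth 0 [:: r1; r2; r3] i) (nth 0 [:: x1; x2; x3] j).
  by rewrite /g /pairing !mxE; apply: eq_bigr => k _; rewrite !mxE.
have : \det (R *m P - l%:M) = 0.
  rewrite -dl (expand_det_row _ 0) !big_ord_recl big_ord0 /cofactor.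
  rewrite !(expand_det_row _ 0) !big_ord_recl !big_ord0 /cofactor !det_mx11.
  rewrite -[RHS]addr0.
  move: RP; set Q := R *m P => RP; clearbody Q.
  rewrite !mxE !RP /= ?mulr1n ?mulr0n; ring.
move/eqP/det0P => [w w0 wG]; apply/eigenvalueP; exists w => //.
by move/eqP: wG; rewrite mulmxBr mul_mx_scalar subr_eq0 => /eqP.
Qed.

Lemma char2_sqr_neq1 (F : fieldType) (u : F) :
  2%N \in [pchar F] -> u != 1 -> u ^+ 2 != 1.
Proof.
move=> ch u1; rewrite -subr_eq0 subr_sqr_1 mulf_neq0 ?subr_eq0 //.
by rewrite -[1](oppr_pchar2 ch) subr_eq0.
Qed.

(* The quartic X^4 - c X - d below is to vanish at [1] and [u], which forces
   c = (1 + u)^3 and d = u (1 + u + u^2). *)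
Lemma quartic_choice (F : fieldType) (u B : F) :
  2%N \in [pchar F] -> u != 0 -> u != 1 ->
  exists w a b, forall l, l \in [:: 1; u] -> w * (a * (l + b) + B * b * l) = l ^+ 4.
Proof.
move=> ch u0 u1; have h2 := pcharf0 ch.
have [d0|d0] := eqVneq (1 + u + u ^+ 2) 0.
  exists 1, 1, 0 => l; rewrite !inE => /orP[]/eqP->; first by ring.
  have -> : u ^+ 4 = u + (u ^+ 2 - u) * (1 + u + u ^+ 2) by ring.
  by rewrite d0; ring.
set d := u * (1 + u + u ^+ 2); set c := (1 + u) ^+ 3.
have dn0 : d != 0 by rewrite mulf_neq0.
have cn0 : c != 0 by rewrite expf_neq0 // -[u](oppr_pchar2 ch) subr_eq0 eq_sym.
(* Comparing coefficients asks for [w * a * b = d] and [w * (a + B * b) = c], hence [b = k^-1] with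
   [k = c / d - B / a], which must be nonzero. If [a = 1] fails, then [B = c / d] is nonzero and
   [a = u] works. *)
have [a a0 ha] : exists2 a, a != 0 & c / d - B / a != 0.
  have [e|ne] := eqVneq (c / d - B / 1) 0; last by exists 1 => //; exact: oner_neq0.
  exists u => //; apply: contra_neq u1 => e'.
  have cd : c / d != 0 by rewrite mulf_neq0 ?invr_eq0.
  apply: (mulfI cd); rewrite mulr1.
  have cdB : c / d = B by apply/eqP; rewrite -subr_eq0 -[B]divr1 e.
  by move/eqP: e'; rewrite subr_eq0 => /eqP e'; rewrite {1}e' divfK.
set k := c / d - B / a in ha.
exists (d * k / a), a, k^-1 => l hl.
have -> : d * k / a * (a * (l + k^-1) + B * k^-1 * l) = d * (k + B / a) * l + d.
  by field; rewrite ha a0.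
have -> : d * (k + B / a) = c by rewrite /k subrK mulrC divfK.
(* The two sides differ by an explicit multiple of [2], written in place of an added zero so that
   [ring] applies. *)
move: hl; rewrite !inE => /orP[]/eqP->; rewrite /c /d -[RHS]addr0.
  by rewrite -(mul0r (2 * u + 2 * u ^+ 2 + u ^+ 3)) -h2; ring.
by rewrite -(mul0r (u + 2 * u ^+ 2 + 2 * u ^+ 3)) -h2; ring.
Qed.

(* 1 + u + u^2 and u + u^2 are the coefficients of (X + 1)(X + u)(X + 1 + u). *)
Lemma cubic_choice_half (F : fieldType) (u p q al be ga de : F) :
  2%N \in [pchar F] -> u != 0 -> u != 1 ->
  (p != 0) || (q != 0) -> (al != 0) || (be != 0) -> ga != 0 ->
  exists A B s t v, let P := v * p in let G := s * ga + v * q in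
    let D := s * de + v * q in
    P ^+ 2 + A * B + t * (G * al + D * be) = 1 + u + u ^+ 2 /\
    t * (P * D * be + A * D * al + G * B * be + P * G * al) = u + u ^+ 2.
Proof.
move=> ch u0 u1 pq albe ga0; have h2 := pcharf0 ch.
set c0 := 1 + u + u ^+ 2; set d0 := u + u ^+ 2.
have c0E : c0 = 1 + d0 by rewrite /c0 addrA.
have d0n : d0 != 0.
  rewrite /d0 -{1}[u]mulr1 expr2 -mulrDr mulf_neq0 //.
  by rewrite -[u](oppr_pchar2 ch) subr_eq0 eq_sym.
have [de0|de0] := eqVneq de 0; last first.
  (* With [v = 0] and [s = 1]: [P = 0], [G = ga], [D = de]. If [ga * al + de * be] is nonzero,
     [A = ga / de] and [B = de / ga] turn both equations into the same one for [t]. *)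
  have [r0|r0] := eqVneq (ga * al + de * be) 0; last first.
    exists (ga / de), (de / ga), 1, (d0 / (ga * al + de * be)), 0 => /=.
    by rewrite c0E; split; field; rewrite ?r0 ?ga0 ?de0.
  have al0 : al != 0.
    apply: contraTneq albe => al0; rewrite al0 eqxx /=.
    move/eqP: r0; rewrite al0 mulr0 add0r mulf_eq0 (negPf de0) /=.
    by move->.
  (* The first equation is now [A * B = c0], and the second determines [t] if its coefficient is
     nonzero: [A = 1] or [A = u] achieves this because [u ^+ 2 != 1]. *)
  suff [A [A0 hA]] : exists A, A != 0 /\ A * de * al + ga * (c0 / A) * be != 0.
    exists A, (c0 / A), 1, (d0 / (A * de * al + ga * (c0 / A) * be)), 0 => /=.
    split; last by rewrite -[RHS](divfK hA); congr (_ * _); ring.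
    rewrite !(mul0r, mul1r, addr0) r0 mulr0 addr0 expr2 mul0r add0r mulrC divfK //.
  have [e|ne] := eqVneq (de * al + ga * c0 * be) 0; last first.
    by exists 1; rewrite oner_neq0 mul1r divr1.
  exists u; split => //; apply: contra_neq (char2_sqr_neq1 ch u1) => e'.
  have dal : de * al != 0 by rewrite mulf_neq0.
  apply: (mulfI dal); apply/eqP; rewrite mulr1 -subr_eq0.
  have -> : de * al * u ^+ 2 - de * al =
    u * (u * de * al + ga * (c0 / u) * be) - (de * al + ga * c0 * be) by field.
  by rewrite e e' mulr0 subr0.
rewrite de0; have [be0|be0] := eqVneq be 0; last first.
  exists ((c0 - ga * al) / (d0 / (ga * be))), (d0 / (ga * be)), 1, 1, 0 => /=.
  by split; field; rewrite ?d0n ?ga0 ?be0.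
have al0 : al != 0 by move: albe; rewrite be0 eqxx orbF.
(* For [q = 0], take [P = 1] and [D = 0]. Otherwise [s] cancels [G], leaving [P ^+ 2 + A * B = c0]
   and [A * q = d0]. *)
have [q0|q0] := eqVneq q 0.
  have p0 : p != 0 by move: pq; rewrite q0 eqxx orbF.
  exists 0, 0, (d0 / ga), al^-1, p^-1 => /=.
  by rewrite c0E q0 be0; split; field; rewrite ?p0 ?al0 ?ga0.
exists (d0 / q), ((c0 - p ^+ 2) / (d0 / q)), (- q / ga), al^-1, 1 => /=.
by rewrite be0; split; field; rewrite ?q0 ?al0 ?ga0 ?d0n.
Qed.

(** The system is invariant under exchanging [A, al, ga] with [B, be, de]. *)
Lemma cubic_choice (F : fieldType) (u p q al be ga de : F) :
  2%N \in [pchar F] -> u != 0 -> u != 1 ->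
  (p != 0) || (q != 0) -> (al != 0) || (be != 0) -> (ga != 0) || (de != 0) ->
  exists A B s t v, let P := v * p in let G := s * ga + v * q in
    let D := s * de + v * q in
    P ^+ 2 + A * B + t * (G * al + D * be) = 1 + u + u ^+ 2 /\
    t * (P * D * be + A * D * al + G * B * be + P * G * al) = u + u ^+ 2.
Proof.
move=> ch u0 u1 pq albe /orP[ga0|de0]; first exact: cubic_choice_half.
have beal : (be != 0) || (al != 0) by rewrite orbC.
have [A [B [s [t [v [/= h1 h2]]]]]] := cubic_choice_half ga ch u0 u1 pq beal de0.
by exists B, A, s, t, v => /=; rewrite -h1 -h2; split; ring.
Qed.

Lemma exists_nonzero_coordinate (F : fieldType) n (chi : 'rV[F]_n) (I : finType)
    (S : {set I}) (x : I -> 'cV_n) (psi : I -> 'rV_n) :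
  chi = \sum_(i in S) pairing chi (x i) *: psi i -> chi != 0 ->
  exists2 i, i \in S & pairing chi (x i) != 0.
Proof.
move=> chiE chi0; apply: contrapT => no; move/eqP: chi0; apply.
rewrite chiE big1 // => i iS.
have [->|nz] := eqVneq (pairing chi (x i)) 0; first by rewrite scale0r.
by case: no; exists i.
Qed.

(** * Existence of an adapted vector or linear form *)

(** Without such a pair, nonvanishing of [pairing phi y] forces [pairing psi x = 0]. An induced
    cycle of basis vectors, their sum [z] and a generic [x] then give four rank one matrices of [V],
    a combination of which has eigenvalues [1] and [u]. *)
Lemma exists_two_cycle (F : fieldType) n (V : {vspace 'M[F]_n}) (u : F) :
  2%N \in [pchar F] -> u != 0 -> u != 1 -> (0 < n)%N ->
  at_most_one_nz_eigenvalue V ->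
  (forall x : 'cV_n, x != 0 ->
     exists phi : 'rV_n, [/\ phi != 0, pairing phi x = 0 & x *m phi \in V]) ->
  exists x phi y psi, [/\ x *m phi \in V, y *m psi \in V,
    pairing phi x = 0 /\ pairing psi y = 0 & pairing phi y = 1 /\ pairing psi x = 1].
Proof.
move=> ch u0 u1 n0 hV nonad; apply: contrapT => no.
have no2 x phi y psi : x *m phi \in V -> y *m psi \in V ->
    pairing phi x = 0 -> pairing psi y = 0 -> pairing phi y != 0 -> pairing psi x = 0.
  move=> xV yV px py pxy; apply/eqP/negPn/negP => pyx; apply: no.
  exists x, ((pairing phi y)^-1 *: phi), y, ((pairing psi x)^-1 *: psi).
  rewrite -!scalemxAr !rpredZ // !pairingZl px py !mulr0.
  by rewrite !mulVf.
pose e i : 'cV[F]_n := delta_mx i 0.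
have e0 i : e i != 0.
  by apply/cV0Pn; exists i; rewrite mxE !eqxx oner_neq0.
have /(fin_all_exists (T := 'I_n))[phi phiP] i := nonad _ (e0 i).
have /(induced_cycle (Ordinal n0))[S [f [S0 fS finj fE]]] i :
    exists j, pairing (phi i) (e j) != 0.
  by apply: exists_pairing_delta_neq0; case: (phiP i).
pose psi i := (pairing (phi i) (e (f i)))^-1 *: phi i.
have psie i j : i \in S -> j \in S -> pairing (psi i) (e j) = (j == f i)%:R.
  move=> iS jS; rewrite pairingZl -(fE i j) //.
  have nz : pairing (phi i) (e (f i)) != 0 by rewrite (fE i (f i)) ?fS.
  have [->|hj] := eqVneq (pairing (phi i) (e j)) 0; first by rewrite mulr0.
  have /eqP-> : j == f i by rewrite -fE.
  by rewrite mulVf.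
have psiV i : e i *m psi i \in V.
  by rewrite -scalemxAr rpredZ //; case: (phiP i).
have psi0 i : pairing (psi i) (e i) = 0.
  by rewrite pairingZl; case: (phiP i) => _ -> _; rewrite mulr0.
have imf : f @: S = S.
  apply/eqP; rewrite eqEcard card_in_imset // leqnn andbT.
  by apply/fintype.subsetP => _ /imsetP[i iS ->]; exact: fS.
have [i0 i0S] := set0Pn _ S0.
pose z := \sum_(i in S) e i.
have psiz i : i \in S -> pairing (psi i) z = 1.
  move=> iS; rewrite pairing_sumr (bigD1 (f i)) ?fS //= psie ?fS // eqxx.
  by rewrite big1 ?addr0 // => j /andP[jS /negPf jf]; rewrite psie // jf.
have z0 : z != 0.
  by apply: contraTneq (oner_neq0 F) => z0; rewrite -(psiz _ i0S) z0 pairing0r eqxx.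
have [theta [th0 thz thV]] := nonad z z0.
have the i : i \in S -> pairing theta (e i) = 0.
  by move=> iS; apply: (no2 _ (psi i) z) => //; rewrite psiz ?oner_neq0.
pose N := \sum_(i in S) e i *m psi i.
pose w := \sum_(i in S) psi i.
(* The projection onto the common kernel of the [psi i] along the span of the [e i], for [i] in
   [S]. *)
pose rho : 'M_n := 1%:M - \sum_(i in S) e (f i) *m psi i.
have NV : N \in V by apply: rpred_sum.
have we i : i \in S -> pairing w (e i) = 1.
  rewrite -{1}imf => /imsetP[k kS ->].
  rewrite pairing_suml (bigD1 k) //= psie ?fS // eqxx.
  rewrite big1 ?addr0 // => j /andP[jS jk].
  by rewrite psie ?fS // (inj_in_eq finj) // eq_sym (negPf jk).
have wN : w *m N = w.
  rewrite mulmx_sumr; apply: eq_bigr => i iS.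
  by rewrite mulmx_rank1_row we // scale1r.
have w0 : w != 0.
  by apply: contraTneq (oner_neq0 F) => w0; rewrite -(we _ i0S) w0 pairing0l eqxx.
have rhoE chi : chi *m rho = chi - \sum_(i in S) pairing chi (e (f i)) *: psi i.
  rewrite mulmxBr mulmx1 mulmx_sumr; congr (_ - _).
  by apply: eq_bigr => i _; rewrite mulmx_rank1_row.
have psirho i : i \in S -> psi i *m rho = 0.
  move=> iS; rewrite rhoE (bigD1 i) //= psie ?fS // eqxx scale1r big1 ?addr0 ?subrr //.
  move=> j /andP[jS jk]; by rewrite psie ?fS // (inj_in_eq finj) // (negPf jk) scale0r.
have Nrho : N *m rho = 0.
  by rewrite mulmx_suml big1 // => i iS; rewrite -mulmxA psirho // mulmx0.
have wrho : w *m rho = 0.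
  by rewrite mulmx_suml big1 // => i iS; rewrite psirho.
have throw : theta *m rho != 0.
  by rewrite rhoE big1 ?subr0 // => i iS; rewrite the ?fS // scale0r.
have [x [[y xE] thx xgood]] := exists_generic_vector hV u0 u1 NV wN w0 Nrho wrho throw.
have x0 : x != 0 by apply: contraNneq thx => ->; rewrite pairing0r.
have [chi [chi0 chix chiV]] := nonad x x0.
have /eqP := xgood _ chiV; rewrite rhoE subr_eq0 => /eqP chiE.
have [k kS chik] := exists_nonzero_coordinate (x := fun i => e (f i)) chiE chi0.
set i := f k in chik; have iS : i \in S by exact: fS.
have jS : f i \in S by exact: fS.
set j := f i in jS *.
have psix k' : k' \in S -> pairing (psi k') x = 0.
  by move=> k'S; rewrite xE -pairing_mulmx psirho ?pairing0l.
have chiz : pairing chi z = 0 by exact: (no2 z theta x).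
have psiij : pairing (psi i) (e j) = 1 by rewrite psie // eqxx.
have psiji : pairing (psi j) (e i) = 0.
  by apply: (no2 (e i) (psi i) (e j)) => //; rewrite psiij oner_neq0.
set A := pairing chi (e i) in chik.
set B := pairing chi (e j).
have [c [a [b hl]]] := quartic_choice (B / A) ch u0 u1.
pose M := (pairing theta x)^-1 *: (z *m theta) + (c / A) *: (x *m chi)
  + a *: (e i *m psi i) + b *: (e j *m psi j).
have MV : M \in V by rewrite !rpredD ?rpredZ.
have ev l : l \in [:: 1; u] -> l != 0 -> eigenvalue M l.
  move=> hl1 l0.
  (* Solving [M *m v = l *: v] from the coordinate [l ^+ 2] on [z] gives these coordinates; the one
     on [x] leaves the quartic condition [hl]. *)
  pose v := l ^+ 2 *: z + l ^+ 3 *: x + (a * (l + b)) *: e i + (b * l) *: e j.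
  have thv : pairing theta v = l ^+ 3 * pairing theta x.
    by rewrite !pairingDr !pairingZr thz !the // !mulr0 add0r !addr0.
  apply: (eigenvalue_col (v := v)); last first.
    apply: contraTneq (expf_neq0 3 l0) => v0; rewrite negbK.
    by move/eqP: thv; rewrite v0 pairing0r eq_sym mulf_eq0 (negPf thx) orbF.
  rewrite !mulmxDl -!scalemxAl !mulmx_rank1_col thv !pairingDr !pairingZr.
  rewrite chiz chix !psiz // !psix // !psi0 psiij psiji -/A -/B.
  rewrite !scalerA !scalerDr !scalerA; congr (_ *: _ + _ *: _ + _ *: _ + _ *: _).
  - by field.
  - rewrite -exprS -(hl l hl1); by field.
  - by ring.
  - by ring.
have : 1 = u by apply: (hV M); rewrite ?oner_neq0 ?ev ?inE ?eqxx ?orbT ?oner_neq0.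
by move=> e1; rewrite e1 eqxx in u1.
Qed.

(* A suitable combination of the five given rank one matrices, acting on the span
   of [e1], [e2], [x], has characteristic polynomial (X + 1)(X + u)(X + 1 + u). *)
Lemma two_cycle_contradiction (F : fieldType) n (V : {vspace 'M[F]_n}) (u : F)
    (e1 e2 x y : 'cV[F]_n) (phi1 phi2 chi phi theta : 'rV[F]_n) :
  2%N \in [pchar F] -> u != 0 -> u != 1 -> at_most_one_nz_eigenvalue V ->
  e1 *m phi1 \in V -> e2 *m phi2 \in V -> x *m chi \in V -> y *m phi \in V ->
  (e1 + e2) *m theta \in V ->
  pairing phi1 e1 = 0 -> pairing phi1 e2 = 1 -> pairing phi1 x = 0 ->
  pairing phi2 e1 = 1 -> pairing phi2 e2 = 0 -> pairing phi2 x = 0 ->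
  pairing phi e1 = 0 -> pairing phi e2 = 0 -> pairing phi x = 1 ->
  pairing chi x = 0 -> pairing theta (e1 + e2) = 0 ->
  y = pairing phi2 y *: e1 + pairing phi1 y *: e2 ->
  (pairing theta e1 != 0) || (pairing theta x != 0) ->
  (pairing chi e1 != 0) || (pairing chi e2 != 0) ->
  (pairing phi2 y != 0) || (pairing phi1 y != 0) -> False.
Proof.
move=> ch u0 u1 hV V1 V2 Vx Vy Vz p11 p12 p1x p21 p22 p2x p1 p2 px chix thz yE.
set p := pairing theta e1; set q := pairing theta x.
set al := pairing chi e1; set be := pairing chi e2.
set ga := pairing phi2 y; set de := pairing phi1 y => pq albe gade.
have h2 := pcharf0 ch.
have [A [B [s [t [v [/=]]]]]] := cubic_choice ch u0 u1 pq albe gade.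
set P := v * p; set G := s * ga + v * q; set D := s * de + v * q => hc hd.
have th2 : pairing theta e2 = p.
  move/eqP: thz; rewrite pairingDr addr_eq0 => /eqP; rewrite -/p => ->.
  by rewrite (oppr_pchar2 ch).
(* Against [e1], [e2], [x], the rows [r1], [r2], [t *: chi] take the values [P, A, G], then
   [B, P, D], then [t * al, t * be, 0]. *)
pose r1 := (A - P) *: phi1 + (s * ga) *: phi + v *: theta.
pose r2 := (B - P) *: phi2 + (s * de) *: phi + v *: theta.
have MV : e1 *m r1 + e2 *m r2 + x *m (t *: chi) \in V.
  have -> : e1 *m r1 + e2 *m r2 + x *m (t *: chi) =
      (A - P) *: (e1 *m phi1) + (B - P) *: (e2 *m phi2) + s *: (y *m phi)
      + v *: ((e1 + e2) *m theta) + t *: (x *m chi).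
    rewrite {1}yE -/ga -/de /r1 /r2 !mulmxDl !mulmxDr -!scalemxAl -!scalemxAr.
    move: (e1 *m phi1) (e2 *m phi2) (x *m chi) (e1 *m phi) (e2 *m phi)
      (e1 *m theta) (e2 *m theta) => m1 m2 m3 m4 m5 m6 m7.
    by apply/matrixP => i j; rewrite !mxE; ring.
  by rewrite !rpredD ?rpredZ.
have ev l : l \in [:: 1; u] -> l != 0 ->
    eigenvalue (e1 *m r1 + e2 *m r2 + x *m (t *: chi)) l.
  move=> hl l0; apply: eigenvalue_sum_rank1 => //=.
  rewrite !pairingDl !pairingZl p11 p12 p1x p21 p22 p2x p1 p2 px chix th2.
  rewrite -/p -/q -/al -/be !(mulr0, mulr1, add0r, addr0) -/P !subrK -/G -/D.
  (* Splitting off a multiple of [2] leaves the cubic whose coefficients [hc] and [hd] prescribe. *)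
  have -> : (P - l) * ((P - l) * - l - D * (t * be)) -
     A * (B * - l - D * (t * al)) + G * (B * (t * be) - (P - l) * (t * al)) =
     - l ^+ 3 + l * (P ^+ 2 + A * B + t * (G * al + D * be))
     + t * (P * D * be + A * D * al + G * B * be + P * G * al)
     + 2%:R * (P * l ^+ 2 - P ^+ 2 * l - t * P * (D * be + G * al)) by ring.
  rewrite h2 mul0r addr0 hc hd.
  move: hl; rewrite !inE => /orP[]/eqP->; rewrite -[RHS](mul0r (u + u ^+ 2)) -h2; ring.
have : 1 = u by apply: (hV _ _ _ MV); rewrite ?oner_neq0 ?ev ?inE ?eqxx ?orbT ?oner_neq0.
by move=> e; rewrite e eqxx in u1.
Qed.

(** If both alternatives fail, start from a two-cycle [e1], [e2]. A generic [x] has its form [chi]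
    in the span of [phi1], [phi2]; dually a generic form [phi] has its vector [y] in the span of
    [e1], [e2]. Together with [theta] these are contradictory. *)
Lemma exists_adapted (F : fieldType) n (V : {vspace 'M[F]_n}) (u : F) :
  2%N \in [pchar F] -> u != 0 -> u != 1 -> (2 < n)%N ->
  at_most_one_nz_eigenvalue V ->
  (exists2 x : 'cV_n, x != 0 & forall phi : 'rV_n, pairing phi x = 0 ->
     x *m phi \in V -> phi = 0) \/
  (exists2 phi : 'rV_n, phi != 0 & forall x : 'cV_n, pairing phi x = 0 ->
     x *m phi \in V -> x = 0).
Proof.
move=> ch u0 u1 n2 hV; apply: contrapT => /not_orP[nc nr].
have nonadc x : x != 0 ->
    exists phi : 'rV_n, [/\ phi != 0, pairing phi x = 0 & x *m phi \in V].
  move=> x0; apply: contrapT => no; apply: nc; exists x => // phi px pV.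
  by apply/eqP/negPn/negP => phi0; apply: no; exists phi.
have nonadr phi : phi != 0 ->
    exists x : 'cV_n, [/\ x != 0, pairing phi x = 0 & x *m phi \in V].
  move=> x0; apply: contrapT => no; apply: nr; exists phi => // x px pV.
  by apply/eqP/negPn/negP => phi0; apply: no; exists x.
have [e1 [phi1 [e2 [phi2 [V1 V2 [p11 p22] [p12 p21]]]]]] :=
  exists_two_cycle ch u0 u1 (leq_trans (isT : 0 < 3)%N n2) hV nonadc.
have pz : pairing phi1 (e1 + e2) = 1 by rewrite pairingDr p11 p12 add0r.
have pw : pairing (phi1 + phi2) e2 = 1 by rewrite pairingDl p12 p22 addr0.
have [theta [th0 thz thV]] : exists theta : 'rV_n,
    [/\ theta != 0, pairing theta (e1 + e2) = 0 & (e1 + e2) *m theta \in V].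
  apply: nonadc; apply: contraTneq (oner_neq0 F) => z0.
  by rewrite -pz z0 pairing0r eqxx.
pose rho : 'M_n := 1%:M - (e1 *m phi2 + e2 *m phi1).
have rhor chi : chi *m rho = chi - (pairing chi e1 *: phi2 + pairing chi e2 *: phi1).
  by rewrite mulmxBr mulmx1 mulmxDr !mulmx_rank1_row.
have rhoc y : rho *m y = y - (pairing phi2 y *: e1 + pairing phi1 y *: e2).
  by rewrite mulmxBl mul1mx mulmxDl !mulmx_rank1_col.
have phi1rho : phi1 *m rho = 0.
  by rewrite rhor p11 p12 scale0r scale1r add0r subrr.
have phi2rho : phi2 *m rho = 0.
  by rewrite rhor p21 p22 scale0r scale1r addr0 subrr.
have rhoe1 : rho *m e1 = 0.
  by rewrite rhoc p21 p11 scale0r scale1r addr0 subrr.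
have rhoe2 : rho *m e2 = 0.
  by rewrite rhoc p22 p12 scale0r scale1r add0r subrr.
(* Otherwise the identity would be a sum of two matrices of rank at most one, against [2 < n]. *)
have rho0 : rho != 0.
  rewrite subr_eq0; apply: contraTneq n2 => e; rewrite -leqNgt.
  rewrite -(mxrank1 F n) e (leq_trans (mxrank_add _ _)) // -[2%N]/(1 + 1)%N leq_add //.
    by rewrite (leq_trans (mxrankM_maxl _ _)) ?rank_leq_col.
  by rewrite (leq_trans (mxrankM_maxl _ _)) ?rank_leq_col.
have rhoid (x : 'cV_n) : rho *m (rho *m x) = rho *m x.
  by rewrite [in LHS](rhoc x) mulmxBr mulmxDr -!scalemxAr rhoe1 rhoe2 !scaler0 addr0 subr0.
(* If [theta *m rho = 0], then [theta] lies in the span of [phi1], [phi2], and any row not killed by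
   [rho] can replace it here. *)
have [theta' th'rho th'E] : exists2 theta' : 'rV_n, theta' *m rho != 0 &
    theta *m rho != 0 -> theta' = theta.
  have [e|ne] := eqVneq (theta *m rho) 0; last by exists theta.
  have [i [j rij]] := matrix0Pn _ rho0.
  exists (delta_mx 0 i) => //; rewrite -rowE.
  by apply/rV0Pn; exists j; rewrite mxE.
pose N := e1 *m phi1 + e2 *m phi2.
have NV : N \in V by rewrite rpredD.
have [x [[y0 xE] th'x xgood]] : exists x : 'cV_n,
    [/\ exists y, x = rho *m y, pairing theta' x != 0
      & forall phi, x *m phi \in V -> phi *m rho = 0].
  apply: (exists_generic_vector (N := N) (w := phi1 + phi2) hV u0 u1) => //.
  - rewrite mulmxDr !mulmx_rank1_row !pairingDl p11 p12 p21 p22 addr0 add0r.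
    by rewrite !scale1r.
  - apply: contraTneq (oner_neq0 F) => w0.
    by rewrite -pw w0 pairing0l eqxx.
  - by rewrite mulmxDl -!mulmxA phi1rho phi2rho !mulmx0 addr0.
  - by rewrite mulmxDl phi1rho phi2rho addr0.
have x0 : x != 0 by apply: contraNneq th'x => ->; rewrite pairing0r.
(* The same argument in the transposed space, with [x^T] as linear form, gives a row [x'^T] nonzero
   at [x]. *)
have [x' [[y1 x'E] xx' x'good]] : exists x' : 'cV_n,
    [/\ exists y, x' = rho^T *m y, pairing x^T x' != 0
      & forall phi, x' *m phi \in (linfun (@trmx F n n) @: V)%VS -> phi *m rho^T = 0].
  apply: (exists_generic_vector (N := N^T) (w := (e1 + e2)^T)
            (at_most_one_nz_eigenvalue_trmx hV) u0 u1).
  - by rewrite memv_trmx_img trmxK.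
  - rewrite -trmx_mul; congr trmx; rewrite mulmxDl !mulmx_rank1_col !pairingDr.
    by rewrite p11 p12 p21 p22 addr0 add0r !scale1r.
  - apply: contraTneq (oner_neq0 F) => /(congr1 trmx); rewrite trmxK trmx0 => w0.
    by rewrite -pz w0 pairing0r eqxx.
  - rewrite -trmx_mul -[RHS]trmx0; congr trmx.
    by rewrite mulmxDr !mulmxA rhoe1 rhoe2 !mul0mx addr0.
  - by rewrite -trmx_mul -[RHS]trmx0 mulmxDr rhoe1 rhoe2 addr0.
  - rewrite -trmx_mul xE rhoid -xE; apply: contra_neq x0 => x0.
    by rewrite -[x]trmxK x0 trmx0.
pose phi := (pairing x^T x')^-1 *: x'^T.
have phix : pairing phi x = 1.
  by rewrite pairingZl -(pairing_tr x'^T) trmxK mulVf.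
have phi0 : phi != 0.
  by apply: contraTneq (oner_neq0 F) => e; rewrite -phix e pairing0l eqxx.
have [y [yn0 _ yV]] := nonadr phi phi0.
have [chi [chi0 chix chiV]] := nonadc x x0.
have yE : y = pairing phi2 y *: e1 + pairing phi1 y *: e2.
  apply/eqP; rewrite -subr_eq0 -rhoc; apply/eqP/trmx_inj; rewrite trmx0 trmx_mul.
  apply: x'good; rewrite memv_trmx_img trmx_mul trmxK.
  have -> : x'^T = pairing x^T x' *: phi by rewrite scalerA mulfV // scale1r.
  by rewrite -scalemxAr rpredZ.
have chiE : chi = pairing chi e1 *: phi2 + pairing chi e2 *: phi1.
  by apply/eqP; rewrite -subr_eq0 -rhor xgood.
have x'e e : rho *m e = 0 -> pairing x'^T e = 0.
  by move=> re; rewrite x'E trmx_mul trmxK pairing_mulmx re pairing0r.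
apply: (two_cycle_contradiction (e1 := e1) (e2 := e2) (x := x) (y := y) (phi1 := phi1)
  (phi2 := phi2) (chi := chi) (phi := phi) (theta := theta) ch u0 u1 hV) => //.
- by rewrite xE -pairing_mulmx phi1rho pairing0l.
- by rewrite xE -pairing_mulmx phi2rho pairing0l.
- by rewrite pairingZl x'e ?mulr0.
- by rewrite pairingZl x'e ?mulr0.
- have [e|ne] := eqVneq (theta *m rho) 0; last by rewrite -th'E // th'x orbT.
  apply/orP; left; apply: contra_neq th0 => te1.
  move/eqP: e; rewrite rhor subr_eq0 te1 scale0r add0r => /eqP ->.
  by move: thz; rewrite pairingDr te1 add0r => ->; rewrite scale0r.
- rewrite -negb_and; apply: contra_neqN chi0 => /andP[/eqP a0 /eqP b0].
  by rewrite chiE a0 b0 !scale0r addr0.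
- rewrite -negb_and; apply: contra_neqN yn0 => /andP[/eqP a0 /eqP b0].
  by rewrite yE a0 b0 !scale0r addr0.
Qed.

(** * The dimension bound by induction on the size *)

Definition dim_bound_and_coset (F : fieldType) n (V : {vspace 'M[F]_n}) : Prop :=
  (\dim V <= 'C(n, 2) + 2)%N /\
  (\dim V = 'C(n, 2) + 2 ->
     forall (A : 'M_n) u, exists2 M, M \in V & eigenvalue (A + M) u)%N.

(** [B] is the quotient map by [x], [C] a section of it, and [psi] the coordinate along [x]: they
    are blocks of an invertible matrix with first column [x] and of its inverse. *)
Lemma column_splitting (F : fieldType) n (x : 'cV[F]_n.+1) : x != 0 ->
  exists (B : 'M[F]_(n, n.+1)) (C : 'M_(n.+1, n)) (psi : 'rV_n.+1),
    [/\ B *m x = 0, B *m C = 1%:M & C *m B + x *m psi = 1%:M].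
Proof.
move=> x0; pose U : 'rV[F]_(1 + n) := delta_mx 0 0.
pose f : 'M[F]_(1 + n) := delta_mx 0 (0 : 'I_1) *m x^T.
have Uf : U *m f = x^T.
  rewrite mulmxA mul_delta_mx; apply/matrixP => i j.
  by rewrite !mxE big_ord1 !mxE !ord1 mul1r.
have [|g gu gE] := @complete_unitmx _ _ _ U f.
  rewrite Uf mxrank_delta rank_rV.
  by apply/eqP; rewrite eqb1; apply: contra_neq x0 => e; rewrite -[x]trmxK e trmx0.
pose P : 'M[F]_(1 + n) := g^T; pose Q : 'M[F]_(1 + n) := invmx P.
have Pu : P \in unitmx by rewrite unitmx_tr.
have Px : lsubmx P = x.
  rewrite -[x]trmxK -Uf gE -rowE; apply/matrixP => i j.
  by rewrite !mxE !ord1; congr (g _ _); exact/val_inj.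
have : Q *m P = 1%:M by exact: mulVmx.
have : P *m Q = 1%:M by exact: mulmxV.
rewrite -[P]hsubmxK -[Q]vsubmxK mul_row_col Px mul_col_row scalar_mx_block.
move=> PQ /eq_block_mx[_ _ h3 h4].
by exists (dsubmx Q), (rsubmx P), (usubmx Q); split=> //; rewrite addrC.
Qed.

(** [M] stabilises the line of [x] and induces [B *m M *m C] on the quotient; row eigenvectors pull
    back along [B]. *)
Lemma eigenvalue_quotient (F : fieldType) n (x : 'cV[F]_n.+1) (B : 'M[F]_(n, n.+1))
    (C : 'M_(n.+1, n)) (psi : 'rV_n.+1) M m a :
  B *m x = 0 -> B *m C = 1%:M -> C *m B + x *m psi = 1%:M ->
  M *m x = m *: x -> eigenvalue (B *m M *m C) a -> eigenvalue M a.
Proof.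
move=> Bx BC CB Mx /eigenvalueP[v vN v0]; apply/eigenvalueP; exists (v *m B).
  have -> : v *m B *m M = v *m (B *m M *m C) *m B.
    have {1}-> : M = M *m C *m B + m *: (x *m psi).
      by rewrite scalemxAl -Mx -!mulmxA -mulmxDr CB mulmx1.
    rewrite mulmxDr -scalemxAr !mulmxA -(mulmxA v B x) Bx mulmx0 mul0mx scaler0 addr0.
    by [].
  by rewrite vN scalemxAl.
by apply: contra_neq v0 => e; rewrite -[v]mulmx1 -BC mulmxA e mul0mx.
Qed.

Lemma dim_bound_adapted (F : fieldType) n (V : {vspace 'M[F]_n.+1}) (c : F)
    (x : 'cV[F]_n.+1) :
  c != 0 -> c != 1 ->
  (forall W : {vspace 'M[F]_n}, at_most_one_nz_eigenvalue W -> dim_bound_and_coset W) ->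
  at_most_one_nz_eigenvalue V -> x != 0 ->
  (forall phi : 'rV_n.+1, pairing phi x = 0 -> x *m phi \in V -> phi = 0) ->
  dim_bound_and_coset V.
Proof.
move=> c0 c1 IH hV x0 xad.
have [B [C [psi [Bx BC CB]]]] := column_splitting x0.
pose ev : 'Hom('M[F]_n.+1, 'cV[F]_n.+1) := linfun (mulmxr x).
have evE M : ev M = M *m x by rewrite lfunE.
pose q : 'Hom('M[F]_n.+1, 'M[F]_n) := linfun (mulmxr C \o mulmx B).
have qE M : q M = B *m M *m C by rewrite lfunE.
pose U := (V :&: lker ev)%VS.
have UP M : M \in U -> M \in V /\ M *m x = 0.
  by rewrite memv_cap memv_ker evE => /andP[-> /eqP].
pose W := (q @: U)%VS.
have WP N : N \in W -> exists M, [/\ M \in V, M *m x = 0 & N = B *m M *m C].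
  by case/memv_imgP => M /UP[MV Mx] ->; exists M.
have dimW : \dim W = \dim U.
  apply: limg_dim_eq; apply/eqP; rewrite -subv0; apply/subvP => M.
  rewrite memv_cap memv_ker qE memv0 => /andP[/UP[MV Mx] /eqP qM].
  (* A kernel element of [q] in [U] has its image in the line of [x], so [xad] kills it. *)
  have BM : B *m M = 0.
    rewrite -[LHS]mulmx1 -CB mulmxDr !mulmxA qM mul0mx -(mulmxA B M) Mx.
    by rewrite mulmx0 mul0mx addr0.
  have ME : M = x *m (psi *m M).
    by rewrite -[LHS]mul1mx -CB mulmxDl -mulmxA BM mulmx0 add0r mulmxA.
  rewrite ME (xad (psi *m M)) ?mulmx0 // -?ME //.
  by rewrite /pairing -mulmxA Mx mulmx0 mxE.
have Wspec : at_most_one_nz_eigenvalue W.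
  move=> N a b /WP[M [MV Mx ->]] a0 b0 ha hb.
  have Mx' : M *m x = 0 *: x by rewrite scale0r.
  by apply: (hV M) => //; apply: (eigenvalue_quotient Bx BC CB Mx').
have [dW cW] := IH W Wspec; rewrite dimW in dW cW.
have dV : (\dim U + \dim (ev @: V) = \dim V)%N by exact: limg_ker_dim.
have dmax : (\dim (ev @: V) <= n.+1)%N.
  by rewrite (leq_trans (dimvS (subvf _))) // dimvf /dim /= muln1.
have full (T : {vspace 'cV[F]_n.+1}) : (n < \dim T)%N -> forall y, y \in T.
  move=> dT y; suff /eqP-> : T == fullv by rewrite memvf.
  by rewrite eqEdim subvf dimvf /dim /= muln1.
have noeig : x \in (ev @: V)%VS -> \dim U <> ('C(n, 2) + 2)%N.
  case/memv_imgP => A AV; rewrite evE => Ax dU.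
  have [N /WP[M [MV Mx ->]] hN] := cW dU (B *m A *m C) c.
  move: c1; rewrite eq_sym => /eqP; apply.
  have AMx : (A + M) *m x = 1 *: x by rewrite mulmxDl Mx addr0 -Ax scale1r.
  apply: (hV (A + M)); rewrite ?oner_neq0 ?rpredD //.
    exact: eigenvalue_col AMx x0.
  by apply: (eigenvalue_quotient Bx BC CB AMx); rewrite mulmxDr mulmxDl.
have binE : ('C(n.+1, 2) = 'C(n, 2) + n)%N by rewrite binS bin1.
have dfull : (n < \dim (ev @: V))%N -> (\dim U < 'C(n, 2) + 2)%N.
  by move=> hn; rewrite ltn_neqAle dW andbT; apply/eqP/noeig/full.
split.
  rewrite -dV binE addnAC; have [hn|hn] := leqP (\dim (ev @: V)) n.
    exact: leq_add.
  by have := leq_add (dfull hn) dmax; rewrite addSn (addnS _ n) ltnS.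
move=> dVE A u; have [hn|hn] := leqP (\dim (ev @: V)) n; last first.
  have /memv_imgP[M MV] := full _ hn (u *: x - A *m x); rewrite evE => ME.
  exists M => //; apply: (eigenvalue_col (v := x)) => //.
  by rewrite mulmxDl -ME addrC subrK.
have [dU dE] : \dim U = ('C(n, 2) + 2)%N /\ \dim (ev @: V) = n.
  move: dVE; rewrite -dV binE addnAC => dVE.
  have dU : \dim U = ('C(n, 2) + 2)%N.
    apply/eqP; rewrite eqn_leq dW -(leq_add2r n) -dVE leq_add2l //.
  by split => //; move/eqP: dVE; rewrite dU eqn_add2l => /eqP.
have xE : x \notin (ev @: V)%VS by apply/negP => /noeig.
(* The image of [V] is a hyperplane missing [x], so some [M] in [V] makes [A - M] stabilise the line
   of [x]; the coset property of [W] then applies in the quotient. *)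
have /memv_addP[y /memv_imgP[M MV]] : A *m x \in (ev @: V + <[x]>)%VS.
  apply: full; rewrite ltnNge; apply: contra xE => d.
  have /eqP-> : (ev @: V)%VS == (ev @: V + <[x]>)%VS by rewrite eqEdim addvSl dE.
  by rewrite memvE addvSr.
rewrite evE => -> [_ /vlineP[k ->] Ax].
have [N /WP[M' [M'V M'x ->]] hN] := cW dU (B *m (A - M) *m C) u.
exists (M' - M); first by rewrite rpredB.
rewrite addrCA.
have AMx : (M' + (A - M)) *m x = k *: x.
  by rewrite mulmxDl M'x add0r mulmxBl Ax addrC addKr.
apply: (eigenvalue_quotient Bx BC CB AMx).
by rewrite mulmxDr mulmxDl addrC.
Qed.

Lemma dim_bound_trmx (F : fieldType) n (V : {vspace 'M[F]_n}) :
  dim_bound_and_coset (linfun (@trmx F n n) @: V)%VS -> dim_bound_and_coset V.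
Proof.
have dE : \dim (linfun (@trmx F n n) @: V) = \dim V.
  apply: limg_dim_eq; apply/eqP; rewrite -subv0; apply/subvP => M.
  by rewrite memv_cap memv_ker lfunE memv0 /= trmx_eq0 => /andP[].
rewrite /dim_bound_and_coset dE => -[d1 d2]; split => // dV A u.
have [M] := d2 dV A^T u; rewrite memv_trmx_img => MV hM.
by exists M^T; rewrite // -eigenvalue_trmx linearD /= trmxK.
Qed.

(** The bound is 3, as the full space contains a diagonal matrix with entries [c] and [1]. In
    dimension 3, one of the two columns takes all values on [V], so it can be adjusted to make a
    basis vector an eigenvector. *)
Lemma dim_bound_2 (F : fieldType) (V : {vspace 'M[F]_2}) (c : F) :
  c != 0 -> c != 1 -> at_most_one_nz_eigenvalue V -> dim_bound_and_coset V.
Proof.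
move=> c0 c1 hV; rewrite /dim_bound_and_coset.
have dfull : \dim (fullv : {vspace 'M[F]_2}) = 4%N by rewrite dimvf.
have d4 : (\dim V <= 4)%N by rewrite -dfull dimvS ?subvf.
split.
  rewrite -ltnS ltn_neqAle d4 andbT; apply: contraNN c1 => dV.
  have VT M : M \in V.
    by suff /eqP-> : V == fullv by [rewrite memvf]; rewrite eqEdim subvf dfull (eqP dV).
  pose M : 'M[F]_2 := diag_mx (\row_j if j == 0 then c else 1).
  have ev (i : 'I_2) : eigenvalue M (if i == 0 then c else 1).
    apply/eigenvalueP; exists (delta_mx 0 i).
      rewrite mul_mx_diag; apply/matrixP => k l; rewrite !mxE mulrC.
      by case: (eqVneq l i) => [->//|_]; rewrite andbF !mulr0.
    by apply/rV0Pn; exists i; rewrite mxE !eqxx oner_neq0.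
  by apply/eqP; apply: (hV M); rewrite ?oner_neq0 ?VT //; [exact: (ev 0)|exact: (ev 1)].
move=> dV A u.
pose e (i : 'I_2) : 'cV[F]_2 := delta_mx i 0.
pose ev i : 'Hom('M[F]_2, 'cV[F]_2) := linfun (mulmxr (e i)).
have evE i M : ev i M = col i M by rewrite lfunE /= -colE.
have dV2 : (\dim V <= \dim (ev 0 @: V) + \dim (ev 1 @: V))%N.
  rewrite -(limg_ker_dim (ev 0) V) addnC leq_add2l.
  rewrite -(@limg_dim_eq _ _ _ (ev 1) (V :&: lker (ev 0))) ?dimvS ?limgS ?capvSl //.
  apply/eqP; rewrite -subv0; apply/subvP => M.
  rewrite !memv_cap !memv_ker !evE memv0 => /andP[/andP[_ /eqP c0M] /eqP c1M].
  apply/eqP/matrixP => i j; rewrite [RHS]mxE.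
  case: (fintype.split (j : 'I_(1 + 1))) (splitK (j : 'I_(1 + 1))) => k; rewrite ord1 => <-.
    by move/matrixP: c0M => /(_ i 0); rewrite !mxE => <-; congr (M _ _); exact/val_inj.
  by move/matrixP: c1M => /(_ i 0); rewrite !mxE => <-; congr (M _ _); exact/val_inj.
have [i di] : exists i, (1 < \dim (ev i @: V))%N.
  have [h|h] := ltnP 1 (\dim (ev 0 @: V)); first by exists 0.
  exists 1; rewrite ltnNge; apply/negP => h'.
  by move: (leq_trans dV2 (leq_add h h')); rewrite dV.
have : u *: e i - A *m e i \in (ev i @: V)%VS.
  suff /eqP-> : (ev i @: V)%VS == fullv by rewrite memvf.
  by rewrite eqEdim subvf dimvf.
case/memv_imgP => M MV; rewrite lfunE /= => ME.
exists M => //; apply: (eigenvalue_col (v := e i)).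
  by rewrite mulmxDl -ME addrC subrK.
by apply/cV0Pn; exists i; rewrite mxE !eqxx oner_neq0.
Qed.

Lemma dim_bound (F : fieldType) n (V : {vspace 'M[F]_n}) (c : F) :
  2%N \in [pchar F] -> c != 0 -> c != 1 -> (1 < n)%N ->
  at_most_one_nz_eigenvalue V -> dim_bound_and_coset V.
Proof.
move=> ch c0 c1; elim: n V => // n IH V; rewrite ltnS leq_eqVlt => /orP[/eqP n1|n1] hV.
  by move: V hV; rewrite -n1 => V; exact: dim_bound_2 c0 c1.
have IH' W := IH W n1.
have [[x x0 xad]|[phi phi0 phiad]] :=
  exists_adapted ch c0 c1 (n1 : 2 < n.+1)%N hV.
  exact: (dim_bound_adapted c0 c1 IH' hV x0 xad).
apply: dim_bound_trmx.
apply: (dim_bound_adapted (x := phi^T) c0 c1 IH').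
- exact: at_most_one_nz_eigenvalue_trmx.
- by rewrite trmx_eq0.
- move=> psi psiphi; rewrite memv_trmx_img trmx_mul trmxK => psiV.
  apply/trmx_inj; rewrite trmx0; apply: phiad => //.
  by rewrite -psiphi -(pairing_tr psi) trmxK.
Qed.

(** * From cardinalities of spectra to eigenvalues *)

Lemma card_le_I1P (T : Type) (A : set T) :
  (A #<= `I_1)%card <-> (forall a b, A a -> A b -> a = b).
Proof.
split=> [/pcard_leP[f] a b Aa Ab | A1].
  apply: (@inj _ _ _ f); rewrite ?inE //.
  have := @funS _ _ _ _ f; move=> fS.
  have := fS a Aa; have := fS b Ab; rewrite /= !ltnS !leqn0.
  by move=> /eqP-> /eqP->.
have [[a Aa]|no] := EM (exists a, A a); last first.
  have -> : A = set0 by apply/seteqP; split=> // a Aa; case: no; exists a.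
  by apply: (@card_le_trans _ _ _ (@set0 nat)); rewrite ?card_le0 ?subset_card_le.
apply: (@card_le_trans _ _ _ ((fun _ => a) @` `I_1)%classic); last exact: card_image_le.
by apply: subset_card_le => b Ab; exists 0%N; rewrite // (A1 _ _ Aa Ab).
Qed.

Lemma exists_neq01 (F : fieldType) :
  ~ ([set: F]%classic #<= `I_2)%card -> exists2 u : F, u != 0 & u != 1.
Proof.
move=> hF; apply: contrapT => no; apply: hF.
apply: (@card_le_trans _ _ _ ((fun i : nat => if i == 0%N then 0 else 1 : F) @` `I_2)%classic);
  last exact: card_image_le.
apply: subset_card_le => u _ /=.
have [->|u0] := eqVneq u 0; first by exists 0%N.
have [->|u1] := eqVneq u 1; first by exists 1%N.
by case: no; exists u.
Qed.

Lemma star_spec_inP (F L : fieldType) (iota : {rmorphism F -> L}) n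
    (S : {vspace 'M[F]_n.+1}) :
  star_spec_in iota S <->
  (forall x a b, x \in S -> a != 0 -> b != 0 -> eigenvalue (map_mx iota x) a ->
     eigenvalue (map_mx iota x) b -> a = b).
Proof.
have SpE x a : (Sp iota x `\ 0)%classic a <-> eigenvalue (map_mx iota x) a /\ a != 0.
  rewrite eigenvalue_root_min mxminpoly_map /Sp /=.
  by split => [[h /eqP a0]|[h /eqP a0]].
split=> h x.
  move=> a b xS a0 b0 ha hb; have /card_le_I1P := h x xS; apply; exact/SpE.
by move=> xS; apply/card_le_I1P => a b /SpE[ha a0] /SpE[hb b0]; exact: (h x).
Qed.

Lemma one_star_specP (F : fieldType) n (S : {vspace 'M[F]_n.+1}) :
  one_star_spec S <-> at_most_one_nz_eigenvalue S.
Proof.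
have idE (x : 'M[F]_n.+1) : map_mx (idfun : {rmorphism F -> F}) x = x.
  by rewrite map_mx_id.
split=> [/star_spec_inP h x a b xS a0 b0|h].
  by rewrite -{1 2}[x]idE; exact: h.
by apply/star_spec_inP => x a b xS a0 b0; rewrite idE; exact: h.
Qed.

(** Distinct eigenvalues in [F] stay distinct eigenvalues under [iota], so the bound over [F] also
    serves over extensions. *)
Lemma star_spec_in_idfun (F L : fieldType) (iota : {rmorphism F -> L}) n
    (S : {vspace 'M[F]_n.+1}) :
  star_spec_in iota S -> one_star_spec S.
Proof.
move=> /star_spec_inP h; apply/one_star_specP => x a b xS a0 b0 ha hb.
by apply: (fmorph_inj iota); apply: (h x); rewrite ?fmorph_eq0 ?eigenvalue_map.
Qed.

(** * A space attaining the bound *)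

(* [M 0 0 = M 1 1] is the trace zero condition of characteristic 2. *)
Definition sl2_upper (L : fieldType) n (M : 'M[L]_n.+2) : Prop :=
  [/\ M 0 0 = M 1 1,
      forall i : 'I_n.+2, (1 < i)%N -> M i i = 0
    & forall i j : 'I_n.+2, (j < i)%N -> (1 < i)%N -> M i j = 0].

(** A nonzero eigenvalue comes from the top left block: if the first two coordinates of a row
    eigenvector vanish, so do the others in turn, the remaining diagonal being zero. *)
Lemma sl2_upper_eigenvalue (L : fieldType) n (M : 'M[L]_n.+2) a :
  sl2_upper M -> a != 0 -> eigenvalue M a -> (a - M 0 0) ^+ 2 = M 0 1 * M 1 0.
Proof.
case=> M11 Mii Mij a0 /eigenvalueP[v vM v0].
have vMj j : a * v 0 j = \sum_i v 0 i * M i j.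
  by move/rowP: vM => /(_ j); rewrite !mxE.
have big2 (j : 'I_n.+2) : (j < 2)%N -> a * v 0 j = v 0 0 * M 0 j + v 0 1 * M 1 j.
  move=> j2; rewrite vMj (bigD1 0) //= (bigD1 1) //= addrA big1 ?addr0 // => i.
  move=> /andP[i0 i1]; have i2 : (1 < i)%N by case: i i0 i1 => -[|[|]].
  by rewrite Mij ?mulr0 // (leq_trans _ i2).
have e0 : (a - M 0 0) * v 0 0 = v 0 1 * M 1 0.
  by rewrite mulrBl big2 // [M 0 0 * _]mulrC addrC addKr.
have e1 : (a - M 0 0) * v 0 1 = v 0 0 * M 0 1.
  by rewrite mulrBl big2 // -M11 [M 0 0 * _]mulrC addrK.
have [v00|v00] := eqVneq (v 0 0) 0; last first.
  apply: (mulIf v00); rewrite expr2 -mulrA e0 mulrA e1; ring.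
have [v01|v01] := eqVneq (v 0 1) 0; last first.
  apply: (mulIf v01); rewrite expr2 -mulrA e1 mulrA e0; ring.
case/eqP: v0; apply/rowP => j; rewrite mxE.
have [k] := ubnP (j : nat); elim: k j => // k IH j jk.
have [j2|j2] := ltnP j 2.
  by case: j j2 {jk} => -[|[|]] //= jn _; [rewrite -[RHS]v00|rewrite -[RHS]v01];
    congr (v 0 _); exact/val_inj.
apply: (mulfI a0); rewrite mulr0 vMj big1 // => i _.
have [ij|ji|ij] := ltngtP i j.
- by rewrite IH ?mul0r // (leq_trans ij).
- by rewrite Mij ?mulr0 // (ltn_trans j2).
- by rewrite (val_inj ij) Mii ?mulr0.
Qed.

Lemma card_lt_pairs n : #|{: {p : 'I_n * 'I_n | p.1 < p.2}%N}| = 'C(n, 2).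
Proof.
rewrite card_sig -sum1_card -bin2_sum big_mkord.
rewrite (eq_bigl (fun p : 'I_n * 'I_n => true && (p.1 < p.2)%N)) //.
rewrite (eq_bigr (fun=> 1%N)) // -(pair_big_dep xpredT (fun i j : 'I_n => (i < j)%N) (fun _ _ => 1%N)).
rewrite (exchange_big_dep xpredT) //=; apply: eq_bigr => j _.
by rewrite -(big_ord_widen _ (fun=> 1%N) (ltnW (ltn_ord j))) sum1_card card_ord.
Qed.

Lemma exists_sl2_upper_space (F : fieldType) n :
  exists S : {vspace 'M[F]_n.+2},
    (forall M, M \in S -> sl2_upper M) /\ \dim S = ('C(n.+2, 2) + 2)%N.
Proof.
pose T := {p : 'I_n.+2 * 'I_n.+2 | p.1 < p.2}%N.
pose I : finType := option (option T).
pose b (i : I) : 'M[F]_n.+2 := match i with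
  | None => delta_mx 0 0 + delta_mx 1 1
  | Some None => delta_mx 1 0
  | Some (Some p) => delta_mx (sval p).1 (sval p).2 end.
pose g (c : {ffun I -> F^o}) : 'M[F]_n.+2 := \sum_i c i *: b i.
have glin : linear g.
  move=> k c d; rewrite /g scaler_sumr -big_split; apply: eq_bigr => i _ /=.
  by rewrite !ffunE scalerDl scalerA.
pose gL := GRing.isLinear.Build _ _ _ _ g glin.
pose gl : {linear {ffun I -> F^o} -> 'M[F]_n.+2} := HB.pack g gL.
pose f := linfun gl.
have fE c : f c = g c by rewrite lfunE.
(* The index [1] of ['I_n.+2] has the value [1 %% n.+2]. *)
have one_mod : (1 %% n.+2 = 1)%N by rewrite modn_small.
have bsl i : sl2_upper (b i).
  case: i => [[[[p q] /= pq]|]|]; split => [|j j1|j k kj j1] /=;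
    rewrite !mxE -!val_eqE /= ?one_mod; do ?[case: eqP => ? /=]; rewrite ?addr0 ?add0r //; exfalso; lia.
have slD (M N : 'M[F]_n.+2) k : sl2_upper M -> sl2_upper N -> sl2_upper (k *: M + N).
  move=> [M1 M2 M3] [N1 N2 N3]; split => [|j j1|j l kj j1]; rewrite !mxE ?M1 ?N1 //.
    by rewrite M2 // N2 // mulr0 addr0.
  by rewrite M3 // N3 // mulr0 addr0.
have sl0 : sl2_upper (0 : 'M[F]_n.+2).
  by split => [|j j1|j l kj j1]; rewrite !mxE.
exists (limg f); split.
  move=> _ /memv_imgP[c _ ->]; rewrite fE /g; elim/big_ind: _ => //.
  - by move=> M N hM hN; rewrite -[M]scale1r; exact: slD.
  - by move=> i _; rewrite -[_ *: _]addr0; exact: slD.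
(* A position where [b i] has entry [1] and all other [b j] vanish, whence linear independence. *)
pose ent (i : I) : 'I_n.+2 * 'I_n.+2 := match i with
  | None => (0, 0) | Some None => (1, 0) | Some (Some p) => sval p end.
have bent i j : b j (ent i).1 (ent i).2 = (j == i)%:R.
  case: i => [[[[p q] pq]|]|]; case: j => [[[[r s] rs]|]|]; first last.
  all: try by rewrite !mxE -?val_eqE /= ?one_mod; do ?[case: eqP => ? /=];
    rewrite ?addr0 ?add0r //; try congruence; exfalso; move: pq || move: rs; rewrite /=; lia.
  rewrite mxE -[RHS]/((((r == p) && (s == q)) : nat)%:R) /=.
  by rewrite (eq_sym r) (eq_sym s).
rewrite limg_dim_eq.
  rewrite dimvf /dim /= !card_option card_lt_pairs.
  by rewrite -[dim _]/1%N muln1 addn2.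
apply/eqP; rewrite -subv0; apply/subvP => c; rewrite memv_cap memvf memv_ker fE memv0.
move=> /= /eqP gc; apply/eqP/ffunP => i; rewrite ffunE.
move/matrixP: gc => /(_ (ent i).1 (ent i).2); rewrite /g summxE (bigD1 i) //= big1.
  by rewrite !mxE bent eqxx mulr1 addr0.
by move=> j ji; rewrite mxE bent (negPf ji) mulr0.
Qed.

(** Squaring is injective in characteristic 2, so the equation of [sl2_upper_eigenvalue] has at most
    one solution in [L]. *)
Lemma sl2_upper_star_spec_in (F L : fieldType) (iota : {rmorphism F -> L}) n
    (S : {vspace 'M[F]_n.+2}) :
  2%N \in [pchar F] -> (forall M, M \in S -> sl2_upper M) -> star_spec_in iota S.
Proof.
move=> ch hS; apply/star_spec_inP => x a b /hS[x1 x2 x3] a0 b0 ha hb.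
have hx : sl2_upper (map_mx iota x).
  by split=> [|i i1|i j ji i1]; rewrite !mxE ?x1 // (x2, x3) ?rmorph0.
have ch' : 2%N \in [pchar L] by apply: rmorph_pchar ch.
have /eqP := sl2_upper_eigenvalue hx b0 hb.
rewrite -(sl2_upper_eigenvalue hx a0 ha) eqf_sqr (oppr_pchar2 ch' (a - _)) orbb.
by move=> /eqP/addIr.
Qed.

(** * The greatest dimension, over the field and over its closure *)

Local Open Scope classical_set_scope.
Local Open Scope card_scope.

Theorem theorem1p6 (n : nat) (F : fieldType)
    (hn : (2 <= n.+1)%N)
    (hchar : 2%N \in [pchar F])
    (hcard : ~ ([set: F] #<= `I_2)) :
  greatest_dim (@one_star_spec F n) ('C(n.+1, 2) + 2)%N /\
  (forall (Fbar : closedFieldType) (iota : {rmorphism F -> Fbar}),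
     is_algebraic_closure iota ->
     greatest_dim (fun S : {vspace 'M[F]_n.+1} => one_bar_star_spec iota S)
       ('C(n.+1, 2) + 2)%N).
Proof.
have [u u0 u1] := exists_neq01 hcard.
have bound (S : {vspace 'M[F]_n.+1}) :
    one_star_spec S -> (\dim S <= 'C(n.+1, 2) + 2)%N.
  by move=> /one_star_specP hS; have [] := dim_bound hchar u0 u1 hn hS.
(* [hn] excludes size 1, so the size takes the form [n.+2] of the extremal space. *)
case: n hn bound => // n _ bound.
have [S [hS dS]] := exists_sl2_upper_space F n.
split=> [|Fbar iota _]; split.
- by exists S => //; exact: sl2_upper_star_spec_in.
- exact: bound.
- by exists S => //; exact: sl2_upper_star_spec_in.
- by move=> T /star_spec_in_idfun; exact: bound.
Qed.
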